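(* Let $Q_0=(Q,* )$ be a noncommutative quasigroup, and suppose that $Q$ is finite. Let $\tau=\{(x_1,y_1),\dots,(x_{r(Q_0)},y_{r(Q_0)})\}$ be a set of representatives of the equivalence classes of $\equiv$ on $Q\times Q\setminus K(Q_0)$. Then $\mathcal{N}(Q_0)=\mathcal{N}_\tau(Q_0)$. In particular, $|\mathcal{N}(Q_0)|=2^{r(Q_0)}$.
   Context: A groupoid is a nonempty set with a binary operation. A groupoid $(Q,* )$ is a quasigroup if for all $a,b\in Q$ the equations $a*x=b$ and $y*a=b$ have unique solutions $x,y\in Q$. For groupoids $(A,* )$ and $(B,\cdot)$, a bijection $f:A\to B$ is a half-isomorphism if $f(x*y)\in\{f(x)\cdot f(y),f(y)\cdot f(x)\}$ for all $x,y\in A$; it is special if $f^{-1}$ is also a half-isomorphism. A principal h-quasigroup of $Q_0=(Q,* )$ is a quasigroup $(Q,\cdot)$ on the same underlying set $Q$ for which the identity mapping $Q_0\to(Q,\cdot)$ is a special half-isomorphism; $\mathcal{N}(Q_0)$ is the set of all principal h-quasigroups of $Q_0$ (two are equal iff their operations coincide). $K(Q_0)=\{(x,y)\in Q\times Q\mid x*y=y*x\}$. For $(x,y),(x',y')\in Q\times Q\setminus K(Q_0)$, write $(x,y)\sim(x',y')$ if one of the following holds: (i) $(x',y')=(y,x)$; (ii) $x=x'$ and $\{x*y,y*x\}\cap\{x*y',y'*x\}\neq\emptyset$; (iii) $y=y'$ and $\{x*y,y*x\}\cap\{x'*y,y*x'\}\neq\emptyset$. Write $(x,y)\equiv(x',y')$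 if there are $z_1,\dots,z_l\in Q\times Q\setminus K(Q_0)$ such that $(x,y)\sim z_1\sim z_2\sim\dots\sim z_l\sim(x',y')$. The relation $\sim$ is reflexive and symmetric, so $\equiv$ is an equivalence relation; $r(Q_0)$ denotes the number of its equivalence classes on $Q\times Q\setminus K(Q_0)$. For $\sigma=(\sigma_1,\dots,\sigma_{r(Q_0)})\in\mathbb{Z}_2^{r(Q_0)}$, with $\mathbb{Z}_2=\{0,1\}$, define the operation $\stackrel{\sigma}{\bullet}$ on $Q$ by: $x\stackrel{\sigma}{\bullet}y=x*y$ if $(x,y)\in K(Q_0)$ or $(x,y)\equiv(x_i,y_i)$ with $\sigma_i=0$; and $x\stackrel{\sigma}{\bullet}y=y*x$ if $(x,y)\equiv(x_i,y_i)$ with $\sigma_i=1$. Put $Q_\sigma=(Q,\stackrel{\sigma}{\bullet})$ and $\mathcal{N}_\tau(Q_0)=\{Q_\sigma\mid\sigma\in\mathbb{Z}_2^{r(Q_0)}\}$. *)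

(* Defs.v *)
From mathcomp Require Import all_boot all_algebra.
From mathcomp Require Import boolp classical_sets functions cardinality.

Set Implicit Arguments.
Unset Strict Implicit.
Unset Printing Implicit Defensive.

Local Open Scope classical_set_scope.

(* A groupoid is given by a carrier together with a plain binary operation on
   it. *)

Definition is_quasigroup (T : Type) (op : T -> T -> T) : Prop :=
  [/\ inhabited T,
      (forall a b : T, exists! x : T, op a x = b) &
      (forall a b : T, exists! y : T, op y a = b)].

Definition noncommutative (T : Type) (op : T -> T -> T) : Prop :=
  exists x y : T, op x y <> op y x.

Definition half_isomorphism (A B : Type) (opA : A -> A -> A)
    (opB : B -> B -> B) (f : A -> B) : Prop :=
  bijective f /\
  forall x y : A, f (opA x y) = opB (f x) (f y) \/
                  f (opA x y) = opB (f y) (f x).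

Definition special_half_isomorphism (A B : Type) (opA : A -> A -> A)
    (opB : B -> B -> B) (f : A -> B) : Prop :=
  half_isomorphism opA opB f /\
  exists g : B -> A, [/\ cancel f g, cancel g f & half_isomorphism opB opA g].

(* The set N(Q_0). Its elements all live on the carrier T, so each of them is
   identified with its operation. *)
Definition principal_h_quasigroups (T : Type) (op : T -> T -> T) :
    set (T -> T -> T) :=
  [set op' | is_quasigroup op' /\ special_half_isomorphism op op' id].

Section FiniteGroupoid.
Variables (Q : finType) (op : Q -> Q -> Q).

(* K(Q_0) *)
Definition commuting_pairs : {set Q * Q} :=
  [set u | op u.1 u.2 == op u.2 u.1]%SET.

Definition noncommuting_pairs : {set Q * Q} := (~: commuting_pairs)%SET.

Definition products (x y : Q) : {set Q} := [set op x y; op y x]%SET.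

(* The relation ~. *)
Definition sim : rel (Q * Q) := fun u v =>
  [&& u \in noncommuting_pairs, v \in noncommuting_pairs &
   [|| v == (u.2, u.1),
       (u.1 == v.1) && (products u.1 u.2 :&: products u.1 v.2 != finset.set0) |
       (u.2 == v.2) && (products u.1 u.2 :&: products v.1 u.2 != finset.set0)]].

(* On noncommuting_pairs, where sim is reflexive, the chains
   u ~ z_1 ~ ... ~ z_l ~ v are exactly the sim-paths of [connect]. Outside,
   [connect] only relates a pair to itself. *)
Definition pair_equiv : rel (Q * Q) := connect sim.

(* r(Q_0) *)
Definition num_classes : nat :=
  #|equivalence_partition pair_equiv noncommuting_pairs|.

Definition class_representatives (tau : 'I_num_classes -> Q * Q) : Prop :=
  (forall i, tau i \in noncommuting_pairs) /\
  (forall u, u \in noncommuting_pairs -> exists! i, pair_equiv u (tau i)).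

(* When tau is a system of representatives, the last case is the one where
   (x, y) is equivalent to some tau i with sigma i = 1. *)
Definition twisted_op (tau : 'I_num_classes -> Q * Q)
    (sigma : {ffun 'I_num_classes -> 'Z_2}) : Q -> Q -> Q := fun x y =>
  if ((x, y) \in commuting_pairs)
     || [exists i, pair_equiv (x, y) (tau i) && (sigma i == 0%R)]
  then op x y else op y x.

(* N_tau(Q_0) *)
Definition twisted_groupoids (tau : 'I_num_classes -> Q * Q) :
    set (Q -> Q -> Q) :=
  range (twisted_op tau).

End FiniteGroupoid.

(* Main.v *)
(** The operation of a principal h-quasigroup is determined by the set of
    noncommuting pairs whose two products it leaves in place.  Cancellation
    makes this set a union of classes of [pair_equiv]: if
    [{xy, yx}] meets [{xy', y'x}] with [y <> y'], then [xy = y'x] or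
    [yx = xy'], and keeping one of the two pairs while swapping the other
    would give [x] the same left or right product with [y] and [y'].
    Conversely, a choice of
    classes to swap always yields a cancellative operation, hence a quasigroup
    since [Q] is finite, and different choices differ at some representative. *)
Require Import Defs.
From mathcomp Require Import all_boot all_algebra.
From mathcomp Require Import boolp classical_sets functions cardinality.

Set Implicit Arguments.
Unset Strict Implicit.
Unset Printing Implicit Defensive.

Local Open Scope classical_set_scope.
Local Open Scope card_scope.

(** * Cancellation and counting in finite types *)

Lemma quasigroup_injl (T : Type) (op : T -> T -> T) :
  is_quasigroup op -> forall a, injective (op a).
Proof.
move=> [_ hl _] a x y exy; have [z [_ uz]] := hl a (op a y).
by rewrite -(uz x exy) (uz y erefl).
Qed.

Lemma quasigroup_injr (T : Type) (op : T -> T -> T) :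
  is_quasigroup op -> forall a, injective (op^~ a).
Proof.
move=> [_ _ hr] a x y exy; have [z [_ uz]] := hr a (op y a).
by rewrite -(uz x exy) (uz y erefl).
Qed.

(** Finiteness turns cancellation into solvability: an injective self-map of [Q] is bijective, and
    its inverse supplies the solution. *)
Lemma fin_quasigroup (Q : finType) (op : Q -> Q -> Q) :
    inhabited Q -> (forall a, injective (op a)) ->
  (forall a, injective (op^~ a)) -> is_quasigroup op.
Proof.
have uniq_sol (f : Q -> Q) b : injective f -> exists! x, f x = b.
  move=> f_inj; have [g _ gK] := injF_bij f_inj.
  by exists (g b); split=> [|x <-]; [exact: gK | apply: f_inj; rewrite gK].
by move=> Q0 injl injr; split=> // a b; apply: uniq_sol.
Qed.

Lemma card_setT_fin (T : finType) : [set: T] #= `I_#|T|.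
Proof.
have -> : [set: T] = [set enum_val i | i in [set: 'I_#|T|]].
  by apply/seteqP; split=> // x _; exists (enum_rank x); rewrite ?enum_rankK.
apply: card_eq_trans (card_esym card_II).
by apply: inj_card_eq => i j _ _; apply: enum_val_inj.
Qed.

(** * The identity as a special half-isomorphism *)

Definition keeps_at (T : Type) (op op' : T -> T -> T) x y : Prop :=
  op' x y = op x y /\ op' y x = op y x.

Definition swaps_at (T : Type) (op op' : T -> T -> T) x y : Prop :=
  op' x y = op y x /\ op' y x = op x y.

(** The two directions together say that [op] and [op'] have the same unordered set of products of
    [x] and [y], so the ordered pair of products is either kept or reversed. *)
Lemma special_half_isomorphism_idP (T : Type) (op op' : T -> T -> T) :
  special_half_isomorphism op op' id <->
  forall x y, keeps_at op op' x y \/ swaps_at op op' x y.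
Proof.
rewrite /keeps_at /swaps_at; split=> [[[_ h] [g [idg _ [_ h']]]] x y|h].
  have {}h' z t : op' z t = op z t \/ op' z t = op t z.
    by have := h' z t; rewrite !(idg : forall z, g z = z).
  move: (h x y) (h y x) (h' x y) (h' y x) => /=.
  by do 4![case=> ?]; (left; split; congruence) || (right; split; congruence).
have bij_id : bijective (@id T) by exists id.
split; last (exists id; split=> //); split=> //= x y.
  by case: (h x y) => -[-> ->]; [left | right].
by case: (h x y) => -[-> _]; [left | right].
Qed.

Section PairEquivalence.
Context {Q : finType} {op : Q -> Q -> Q}.
Implicit Types (x y : Q) (u v : Q * Q).

Lemma in_commuting x y :
  ((x, y) \in commuting_pairs op) = (op x y == op y x).
Proof. by rewrite inE. Qed.

Lemma in_noncommuting x y :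
  ((x, y) \in noncommuting_pairs op) = (op x y != op y x).
Proof. by rewrite !inE. Qed.

Lemma productsC x y : products op x y = products op y x.
Proof. exact: finset.setUC. Qed.

Lemma sim_swap x y :
  (x, y) \in noncommuting_pairs op -> sim op (x, y) (y, x).
Proof.
by rewrite /sim !in_noncommuting /= eqxx => h; rewrite h eq_sym h.
Qed.

End PairEquivalence.

(** * A principal h-quasigroup treats each class uniformly *)

Section Preserved.
Context {Q : finType} {op op' : Q -> Q -> Q}.
Hypotheses (hQ : is_quasigroup op) (hQ' : is_quasigroup op').
Hypothesis half_id : special_half_isomorphism op op' id.

Let preserved : pred (Q * Q) := fun u => op' u.1 u.2 == op u.1 u.2.

Lemma not_preserved x y : ~~ preserved (x, y) -> op' x y = op y x.
Proof.
rewrite /preserved /=.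
by case: ((special_half_isomorphism_idP _ _).1 half_id x y) => -[-> _] /eqP.
Qed.

Lemma preserved_swap x y : preserved (x, y) = preserved (y, x).
Proof.
rewrite /preserved /=.
case: ((special_half_isomorphism_idP _ _).1 half_id x y) => -[-> ->].
  by rewrite !eqxx.
by rewrite eq_sym.
Qed.

Lemma preserved_products x y y' :
    products op x y :&: products op x y' != finset.set0 ->
  preserved (x, y) = preserved (x, y').
Proof.
have [-> //|neq_yy'] := eqVneq y y'.
(* Keeping at [z] and swapping at [z'] forces [op' x z = op' x z']; the opposite choice forces
   [op' z x = op' z' x]. Each case needs its own cancellation law of [op']. *)
have crossed z z' : z != z' -> op x z = op z' x ->
    preserved (x, z) = preserved (x, z').
  move=> neq_zz' e; apply: contra_neq_eq neq_zz'.
  have [/eqP h|h] := boolP (preserved (x, z)).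
    have [//|/not_preserved h' _] := boolP (preserved (x, z')).
    by apply: (@quasigroup_injl _ _ hQ' x); rewrite h h'.
  have [|//] := boolP (preserved (x, z')).
  move: h; rewrite preserved_swap => /not_preserved h.
  rewrite preserved_swap => /eqP h' _.
  by apply: (@quasigroup_injr _ _ hQ' x); rewrite h h'.
(* Of the four coincidences, the two with [x] on the same side contradict [y != y'] by cancellation
   in [op]; the mixed ones are [crossed]. *)
case/finset.set0Pn=> w; rewrite !inE => /andP[/orP[]/eqP-> /orP[]/eqP e].
- by rewrite (quasigroup_injl hQ e) eqxx in neq_yy'.
- exact: crossed.
- by symmetry; apply: crossed; rewrite 1?eq_sym.
- by rewrite (quasigroup_injr hQ e) eqxx in neq_yy'.
Qed.

Lemma preserved_equiv u v : pair_equiv op u v -> preserved u = preserved v.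
Proof.
apply: (@closed_connect _ _ preserved) => {u v} -[x y] [x' y'] /and3P[_ _ /=].
case/or3P=> [/eqP[-> ->]|/andP[/eqP <- h]|/andP[/eqP <- h]].
- exact: preserved_swap.
- exact: preserved_products.
(* Reversing both pairs turns a common second entry into a common first entry. *)
- rewrite 2![_ \in _]preserved_swap.
  by apply: preserved_products; rewrite ![products _ y _]productsC.
Qed.

End Preserved.

(** * Swapping a chosen family of classes *)

Section Twist.
Context {Q : finType} {op : Q -> Q -> Q}.
Hypothesis hQ : is_quasigroup op.
Context {tau : 'I_(num_classes op) -> Q * Q}.
Hypothesis htau : class_representatives tau.
Implicit Types (sigma : {ffun 'I_(num_classes op) -> 'Z_2}).

Lemma twisted_op_commuting sigma x y :
  op x y = op y x -> twisted_op tau sigma x y = op x y.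
Proof. by rewrite /twisted_op in_commuting => ->; rewrite eqxx. Qed.

(** Uniqueness of the representative collapses the existential in [twisted_op] to the index [i]. *)
Lemma twisted_op_equiv sigma x y i :
    (x, y) \in noncommuting_pairs op -> pair_equiv op (x, y) (tau i) ->
  twisted_op tau sigma x y = if sigma i == 0%R then op x y else op y x.
Proof.
move=> nc xyi; have [j [_ uj]] := htau.2 _ nc.
rewrite /twisted_op in_commuting.
rewrite in_noncommuting in nc; rewrite (negPf nc) /=; congr (if _ then _ else _).
apply/existsP/idP => [[k /andP[xyk]]|s0]; last by exists i; rewrite xyi.
by rewrite -(uj _ xyk) (uj _ xyi).
Qed.

Lemma twisted_op_equiv2 sigma x y i :
    (x, y) \in noncommuting_pairs op -> pair_equiv op (x, y) (tau i) ->
  if sigma i == 0%R then keeps_at op (twisted_op tau sigma) x y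
  else swaps_at op (twisted_op tau sigma) x y.
Proof.
move=> nc xyi.
have nc' : (y, x) \in noncommuting_pairs op.
  by move: nc; rewrite !in_noncommuting eq_sym.
have yxi : pair_equiv op (y, x) (tau i).
  by apply: connect_trans xyi; apply: connect1; apply: sim_swap.
rewrite /keeps_at /swaps_at (twisted_op_equiv _ nc xyi).
by rewrite (twisted_op_equiv _ nc' yxi); case: eqP.
Qed.

Lemma twisted_op_keeps_or_swaps sigma x y :
  keeps_at op (twisted_op tau sigma) x y \/
  swaps_at op (twisted_op tau sigma) x y.
Proof.
have [e|nc] := eqVneq (op x y) (op y x).
  by left; split; apply: twisted_op_commuting.
rewrite -in_noncommuting in nc; have [i [xyi _]] := htau.2 _ nc.
by have := twisted_op_equiv2 sigma nc xyi; case: ifP; [left | right].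
Qed.

Lemma twisted_op_products sigma x y : twisted_op tau sigma x y \in products op x y.
Proof.
by rewrite !inE; case: (twisted_op_keeps_or_swaps sigma x y) => -[-> _];
  rewrite eqxx ?orbT.
Qed.

(** Two noncommuting pairs that meet are related by [sim], so the same entry of [sigma] governs
    both. A commuting pair is both kept and swapped, so it agrees with whatever happens to the
    other. *)
Lemma twisted_op_meet sigma x y y' :
    products op x y :&: products op x y' != finset.set0 ->
  (keeps_at op (twisted_op tau sigma) x y /\
   keeps_at op (twisted_op tau sigma) x y') \/
  (swaps_at op (twisted_op tau sigma) x y /\
   swaps_at op (twisted_op tau sigma) x y').
Proof.
move=> meet.
have commutes z : op x z = op z x ->
    keeps_at op (twisted_op tau sigma) x z /\
    swaps_at op (twisted_op tau sigma) x z.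
  by move=> e; do 2!split; rewrite ?e ?twisted_op_commuting.
have [/commutes[? ?]|nc] := eqVneq (op x y) (op y x).
  by case: (twisted_op_keeps_or_swaps sigma x y'); [left | right].
have [/commutes[? ?]|nc'] := eqVneq (op x y') (op y' x).
  by case: (twisted_op_keeps_or_swaps sigma x y); [left | right].
rewrite -!in_noncommuting in nc nc'; have [i [xy'i _]] := htau.2 _ nc'.
have xyi : pair_equiv op (x, y) (tau i).
  apply: connect_trans xy'i; apply: connect1.
  by rewrite /sim nc nc' /= eqxx meet orbT.
have := twisted_op_equiv2 sigma nc xyi.
by have := twisted_op_equiv2 sigma nc' xy'i; case: ifP; [left | right].
Qed.

Lemma twisted_op_injl sigma x : injective (twisted_op tau sigma x).
Proof.
move=> y y' e; case: (@twisted_op_meet sigma x y y').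
(* By [e] the common twisted product lies in both product sets. *)
- apply/finset.set0Pn; exists (twisted_op tau sigma x y).
  by rewrite inE twisted_op_products e twisted_op_products.
- by case=> -[exy _] [exy' _]; apply: (@quasigroup_injl _ _ hQ x); rewrite -exy e.
- by case=> -[exy _] [exy' _]; apply: (@quasigroup_injr _ _ hQ x); rewrite -exy e.
Qed.

Lemma twisted_op_injr sigma x : injective ((twisted_op tau sigma)^~ x).
Proof.
move=> y y' e; case: (@twisted_op_meet sigma x y y').
- apply/finset.set0Pn; exists (twisted_op tau sigma y x).
  by rewrite inE ![products _ x _]productsC twisted_op_products e
    twisted_op_products.
- by case=> -[_ exy] [_ exy']; apply: (@quasigroup_injr _ _ hQ x); rewrite -exy e.
- by case=> -[_ exy] [_ exy']; apply: (@quasigroup_injl _ _ hQ x); rewrite -exy e.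
Qed.

Lemma twisted_op_principal sigma :
  principal_h_quasigroups op (twisted_op tau sigma).
Proof.
split; last exact/special_half_isomorphism_idP/twisted_op_keeps_or_swaps.
case: hQ => Q0 _ _.
by apply: fin_quasigroup => // x; [apply: twisted_op_injl|apply: twisted_op_injr].
Qed.

Lemma principal_twisted_op (op' : Q -> Q -> Q) :
  principal_h_quasigroups op op' -> exists sigma, twisted_op tau sigma = op'.
Proof.
move=> [hQ' half_id].
(* [sigma] records what [op'] does at each representative; [preserved_equiv] carries this to the
   whole class. *)
pose sigma : {ffun 'I_(num_classes op) -> 'Z_2} := [ffun i =>
  if op' (tau i).1 (tau i).2 == op (tau i).1 (tau i).2 then 0%R else 1%R].
exists sigma; apply/funext => x; apply/funext => y.
have ks := (special_half_isomorphism_idP _ _).1 half_id x y.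
have [e|nc] := eqVneq (op x y) (op y x).
  by rewrite twisted_op_commuting //; case: ks => -[-> _].
rewrite -in_noncommuting in nc; have [i [xyi _]] := htau.2 _ nc.
rewrite (twisted_op_equiv _ nc xyi) ffunE.
rewrite -(preserved_equiv hQ hQ' half_id xyi) /=.
by case: (op' x y =P op x y) => [->|ne] //=; case: ks => -[e _]; rewrite e in ne *.
Qed.

Lemma twisted_op_inj : injective (twisted_op tau).
Proof.
move=> sigma sigma' e; apply/ffunP => i.
have [x [y ti]] : exists x y, tau i = (x, y) by case: (tau i) => x y; exists x, y.
have nc : (x, y) \in noncommuting_pairs op by rewrite -ti; apply: htau.1.
have xyi : pair_equiv op (x, y) (tau i) by rewrite ti; apply: connect0.
have := twisted_op_equiv sigma nc xyi.
rewrite e (twisted_op_equiv sigma' nc xyi).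
move: nc; rewrite in_noncommuting => /eqP nc.
(* At a representative the two products differ, so the value of the operation reveals whether
   [sigma i] is zero. *)
case: eqP => [->|s]; case: eqP => [->|s'] // exy.
by case: nc; rewrite exy.
have eq1 (a : 'Z_2) : a <> 0%R -> a = 1%R.
  by case: a => -[|[|//]] ? a0; [case: a0|]; apply: val_inj.
by rewrite (eq1 _ s) (eq1 _ s').
Qed.

End Twist.

Theorem theorem5p2 (Q : finType) (op : Q -> Q -> Q)
    (hQ : is_quasigroup op) (hnc : noncommutative op)
    (tau : 'I_(num_classes op) -> Q * Q)
    (htau : class_representatives tau) :
  principal_h_quasigroups op = twisted_groupoids tau /\
  principal_h_quasigroups op #= `I_(2 ^ num_classes op).
Proof.
have -> : principal_h_quasigroups op = twisted_groupoids tau.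
  apply/seteqP; split=> [op'|_ [sigma _ <-]].
    by move=> /(principal_twisted_op hQ htau)[sigma <-]; exists sigma.
  exact: twisted_op_principal.
split=> //.
(* There are 2 to the power [num_classes op] choices of [sigma], and injectivity transfers this
   count to the range. *)
have := card_setT_fin {ffun 'I_(num_classes op) -> 'Z_2}.
rewrite card_ffun !card_ord; apply: card_eq_trans.
by apply: inj_card_eq => ? ? _ _; apply: twisted_op_inj.
Qed.
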